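(* Let $r\ge 1$ and $2\le \ell_1\le\cdots\le\ell_r$ be integers, and let $k\ge 1$ and $n_1,\dots,n_k\ge 1$ be integers. Then $$F\big(2^{k-1}n_1\cdots n_k,\ \mathcal L^{(r)}_{\ell_1,\dots,\ell_r}\big)\ge F\big(\mathbb Z_{n_1}\times\cdots\times\mathbb Z_{n_k},\ \mathcal L^{(r)}_{\ell_1,\dots,\ell_r}\big).$$
   Context: $\mathbb Z_m$ denotes the cyclic group $\mathbb Z/m\mathbb Z$. For an abelian group $G$, a set $A\subset G$ is called $\mathcal L^{(r)}_{\ell_1,\dots,\ell_r}$-free if $A$ contains no sumset $L_1+\cdots+L_r=\{\lambda_1+\cdots+\lambda_r:\lambda_i\in L_i\}$ with $L_i\subset G$ and $|L_i|=\ell_i$ for $i=1,\dots,r$. (The sums need not be pairwise distinct.) For a positive integer $n$, $F\big(n,\mathcal L^{(r)}_{\ell_1,\dots,\ell_r}\big)$ denotes the largest size of an $\mathcal L^{(r)}_{\ell_1,\dots,\ell_r}$-free set of integers contained in $\{1,\dots,n\}$ (with ambient group $\mathbb Z$). For a finite abelian group $G$, $F\big(G,\mathcal L^{(r)}_{\ell_1,\dots,\ell_r}\big)$ denotes the largest size of an $\mathcal L^{(r)}_{\ell_1,\dots,\ell_r}$-free set in $G$. *)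

(* Defs.v *)
From HB Require Import structures.
From mathcomp Require Import all_boot all_order all_algebra.
From mathcomp Require Import finmap.
From mathcomp Require Import boolp classical_sets.

Set Implicit Arguments.
Unset Strict Implicit.
Unset Printing Implicit Defensive.

Import GRing.Theory.
Local Open Scope ring_scope.

(* The library only makes non-dependent finite functions into Z-modules. *)
Section DirectProduct.
Variables (I : finType) (G : I -> finZmodType).
Implicit Types x y z : {dffun forall i, G i}.

Definition dffun_zero : {dffun forall i, G i} := [ffun i => 0 : G i].
Definition dffun_opp x : {dffun forall i, G i} := [ffun i => - x i].
Definition dffun_add x y : {dffun forall i, G i} := [ffun i => x i + y i].

Fact dffun_addA : associative dffun_add.
Proof. by move=> x y z; apply/ffunP => i; rewrite !ffunE addrA. Qed.

Fact dffun_addC : commutative dffun_add.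
Proof. by move=> x y; apply/ffunP => i; rewrite !ffunE addrC. Qed.

Fact dffun_add0 : left_id dffun_zero dffun_add.
Proof. by move=> x; apply/ffunP => i; rewrite !ffunE add0r. Qed.

Fact dffun_addN : left_inverse dffun_zero dffun_opp dffun_add.
Proof. by move=> x; apply/ffunP => i; rewrite !ffunE addNr. Qed.

HB.instance Definition _ := GRing.isZmodule.Build {dffun forall i, G i}
  dffun_addA dffun_addC dffun_add0 dffun_addN.

End DirectProduct.

(* The cyclic group Z/mZ for m >= 1; ['Z_m] is not used because ['Z_1] has
   two elements. *)
Definition cyc (m : nat) : finZmodType := 'I_m.-1.+1.

Definition cyc_prod (k : nat) (n : 'I_k -> nat) : finZmodType :=
  {dffun forall i : 'I_k, cyc (n i)}.

Definition sumset (G : zmodType) (r : nat) (L : 'I_r -> {fset G}) : set G :=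
  [set x | exists2 lam : 'I_r -> G,
             forall i, lam i \in L i & x = \sum_(i < r) lam i]%classic.

Definition Lfree (G : zmodType) (r : nat) (l : 'I_r -> nat) (A : set G) : Prop :=
  ~ exists2 L : 'I_r -> {fset G},
      forall i, #|` L i|%fset = l i & (sumset L `<=` A)%classic.

(* The largest size of an [l]-free subset of [U]. When every [l i] is positive
   the empty set is free, so this is a maximum over a nonempty family. *)
Definition max_Lfree (G : zmodType) (r : nat) (l : 'I_r -> nat) (U : {fset G})
    : nat :=
  \max_(A <- fpowerset U | `[< Lfree l [set` A]%classic >]) #|` A|%fset.

Definition F_int (n r : nat) (l : 'I_r -> nat) : nat :=
  max_Lfree l [fset i%:Z | i in iota 1 n]%fset.

Definition F_grp (G : finZmodType) (r : nat) (l : 'I_r -> nat) : nat :=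
  max_Lfree l [fset x | x in G]%fset.

(* Main.v *)
Require Import Defs.
From mathcomp Require Import all_boot all_order all_algebra.
From mathcomp Require Import finmap.
From mathcomp Require Import boolp classical_sets.
From mathcomp Require Import zify.

(** Let [k >= 1], and read the residues of [x] in
    [Z_(n_1) x ... x Z_(n_k)], taken in [0, n_i), as the digits of an integer
    [e x - 1] in the mixed radix [2 n_1, ..., 2 n_k]. Two things follow from the
    bases being twice as large as needed.

    - Adding two such integers produces no carry, so
      [e x + e y = e z + e w] forces [x + y = z + w] digit by digit: the
      inverse of [e] is a Freiman homomorphism of order 2
      ([mixed_radix_inj], [embed_reflects_sum2]).
    - The integer [2 (e x - 1)] still has legal digits, so it is smaller than
      the product [2^k n_1 ... n_k] of the bases, and hence [e x] lies in
      [{1, ..., 2^(k-1) n_1 ... n_k}] ([embed_bound]).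

    It remains to see that a map with the first property sends free sets to free
    sets ([Lfree_image]). Order 2 is enough whatever the number [r] of summands,
    because one may pass from a base point [a_1 + ... + a_r] of a sumset to
    another point [lam_1 + ... + lam_r] by changing one summand at a time, each
    change being an equation between sums of two elements of the sumset
    ([sumset_telescope]). So a sumset inside [e @` A] pulls back to a sumset of
    the same shape inside [A]. *)

Set Implicit Arguments.
Unset Strict Implicit.
Unset Printing Implicit Defensive.

Import GRing.Theory.

Section FreimanEmbedding.
Local Open Scope ring_scope.
Variables (H G : zmodType) (e : H -> G).

(** Half of a Freiman isomorphism of order 2: relations between sums of two
    elements are pulled back along [e]. *)
Definition reflects_sum2 :=
  forall x y z w : H, e x + e y = e z + e w -> x + y = z + w.

Lemma reflects_sum2_inj : reflects_sum2 -> injective e.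
Proof. by move=> e2 x y exy; apply: (@addIr _ x); apply: e2; rewrite exy. Qed.

(** With [f] inverting [e] on the sumset, [f] is affine in each summand.
    The seq [s] lists the summands already moved from the base point [a] to
    [lam]; moving summand [i] too turns the current point [b] into [b'] with
    [b' + \sum_j a j = b + (lam i + (\sum_j a j - a i))], all four terms being
    points of the sumset. *)
Lemma sumset_telescope (r : nat) (L : 'I_r -> {fset G}) (f : G -> H)
    (a lam : 'I_r -> G) :
  reflects_sum2 ->
  (forall z, sumset L z -> e (f z) = z) ->
  (forall i, a i \in L i) -> (forall i, lam i \in L i) ->
  f (\sum_i lam i) =
  f (\sum_i a i)
  + \sum_i (f (lam i + (\sum_j a j - a i)) - f (\sum_j a j)).
Proof.
move=> e2 fK aL lamL; set S := \sum_i a i.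
pose mix (s : seq 'I_r) := \sum_i (if i \in s then lam i else a i).
have mixP s : sumset L (mix s).
  by exists (fun i => if i \in s then lam i else a i) => // i; case: ifP.
have mix0 : mix [::] = S by apply: eq_bigr.
have mix_cons i s : i \notin s -> mix (i :: s) + a i = mix s + lam i.
  move=> iNs; rewrite /mix (bigD1 i) //= inE eqxx /=.
  rewrite [in RHS](bigD1 i) //= (negPf iNs) addrAC [in RHS]addrAC.
  rewrite [lam i + _]addrC; congr (_ + _).
  by apply: eq_bigr => j /negPf ji; rewrite inE ji.
have mix1 i : mix [:: i] = lam i + (S - a i).
  by apply: (@addIr _ (a i)); rewrite mix_cons // mix0 addrA subrK addrC.
have step s : uniq s ->
    f (mix s) = f S + \sum_(i <- s) (f (lam i + (S - a i)) - f S).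
  elim: s => [|i s IHs] /=; first by rewrite big_nil addr0 mix0.
  case/andP=> iNs /IHs {}IHs; rewrite big_cons addrCA -IHs.
  apply: (@addIr _ (f S)); rewrite addrAC subrK.
  rewrite [RHS]addrC -mix1 -mix0; apply: e2; rewrite !fK //.
  apply: (@addIr _ (a i)); rewrite addrAC mix_cons // mix0.
  by rewrite mix1 !addrA subrK.
have -> : \sum_i lam i = mix (index_enum 'I_r).
  by apply: eq_bigr => i _; rewrite mem_index_enum.
exact/step/index_enum_uniq.
Qed.

(** A sumset [L_1 + ... + L_r] inside [e @` A] is pulled back summand by summand:
    [L_i] itself need not meet the image of [e], but its translate by
    [\sum_(j != i) a j], with [a j] in [L_j], lies in the sumset, where [e] can
    be inverted. *)
Lemma Lfree_image (r : nat) (l : 'I_r -> nat) (A : set H) :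
  (0 < r)%N -> (forall i, 0 < l i)%N -> reflects_sum2 ->
  Lfree l A -> Lfree l (e @` A)%classic.
Proof.
move=> r_gt0 l_gt0 e2 freeA [L sizeL LA]; apply: freeA.
have e_inj := reflects_sum2_inj e2.
have /choice[a aL] : forall i, exists x, x \in L i.
  by move=> i; apply/fset0Pn; rewrite -cardfs_gt0 sizeL.
have /choice[f fP] : forall z, exists x, sumset L z -> A x /\ e x = z.
  move=> z; have [/LA[x Ax <-]|nz] := pselect (sumset L z); first by exists x.
  by exists 0.
have fK z : sumset L z -> e (f z) = z by move=> /fP[].
pose S := \sum_i a i.
have shiftP i x : x \in L i -> sumset L (x + (S - a i)).
  move=> xL; exists (fun j => if j == i then x else a j).
    by move=> j; case: eqP => [->|].
  rewrite [RHS](bigD1 i) //= eqxx; congr (_ + _).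
  rewrite /S (bigD1 i) //= addrAC subrr add0r.
  by apply: eq_bigr => j /negPf ->.
(* By [sumset_telescope], [f] of a sum is [f S] plus one term for each summand;
   [c] adds that constant to a single one of the new summands. *)
pose i0 : 'I_r := Ordinal r_gt0.
pose c i : H := if i == i0 then f S else 0.
pose g i x := f (x + (S - a i)) - f S + c i.
exists (fun i => [fset g i x | x in L i]%fset) => [i|_ [mu muL ->]].
  rewrite -(sizeL i) card_in_imfset // => x y /= xL yL /addIr/addIr fxy.
  by apply: (@addIr _ (S - a i)); rewrite -(fK _ (shiftP _ _ xL)) fxy fK //;
    exact: shiftP.
have /choice[lam lamP] : forall i, exists x, x \in L i /\ mu i = g i x.
  by move=> i; have /imfsetP[x /= xL ->] := muL i; exists x.
have lamL i : lam i \in L i by case: (lamP i).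
rewrite (eq_bigr (fun i => g i (lam i))); last by move=> i _; case: (lamP i).
rewrite big_split /= -big_mkcond big_pred1_eq addrC.
rewrite -(sumset_telescope e2 fK aL lamL).
by case: (fP (\sum_i lam i)) => //; exists lam.
Qed.

Lemma max_Lfree_embed (r : nat) (l : 'I_r -> nat) (U : {fset H})
    (V : {fset G}) :
  (0 < r)%N -> (forall i, 0 < l i)%N -> reflects_sum2 ->
  {in U, forall x, e x \in V} -> (max_Lfree l U <= max_Lfree l V)%N.
Proof.
move=> r_gt0 l_gt0 e2 UV; apply/bigmax_leqP_seq => A.
rewrite fpowersetE => /fsubsetP AU /asboolP freeA.
have <- : #|` [fset e x | x in A] |%fset = #|` A|%fset.
  by rewrite card_imfset //; apply: reflects_sum2_inj.
apply: (@leq_bigmax_seq _ _ _ (fun A : {fset G} => #|` A|%fset)).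
  by rewrite fpowersetE; apply/fsubsetP => _ /imfsetP[x /= /AU xU ->]; apply: UV.
apply/asboolP; suff -> : [set` [fset e x | x in A]%fset]%classic
    = (e @` [set` A])%classic by apply: Lfree_image.
apply/seteqP; split=> y /=; first by case/imfsetP=> x /= xA ->; exists x.
by case=> x xA <-; apply/imfsetP; exists x.
Qed.

End FreimanEmbedding.

Definition mixed_radix (k : nat) (b u : 'I_k -> nat) : nat :=
  \sum_(i < k) u i * \prod_(j < k | j < i) b j.

Lemma mixed_radix_recl (k : nat) (b u : 'I_k.+1 -> nat) :
  mixed_radix b u =
  mixed_radix (b \o lift ord0) (u \o lift ord0) * b ord0 + u ord0.
Proof.
rewrite /mixed_radix big_ord_recl big_pred0 // muln1 addnC; congr (_ + _).
rewrite big_distrl; apply: eq_bigr => i _ /=.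
rewrite -mulnA; congr (_ * _).
rewrite big_mkcond big_ord_recl /= -big_mkcond.
exact: mulnC.
Qed.

Lemma mixed_radixD (k : nat) (b u v : 'I_k -> nat) :
  mixed_radix b (fun i => u i + v i) = mixed_radix b u + mixed_radix b v.
Proof. by rewrite -big_split; apply: eq_bigr => i _; rewrite mulnDl. Qed.

Lemma mixed_radix_lt (k : nat) (b u : 'I_k -> nat) :
  (forall i, u i < b i) -> mixed_radix b u < \prod_(i < k) b i.
Proof.
elim: k b u => [|k IHk] b u ub; first by rewrite /mixed_radix !big_ord0.
rewrite mixed_radix_recl big_ord_recl /=.
have := IHk (b \o lift ord0) (u \o lift ord0) (fun i => ub _).
have := ub ord0; rewrite /=; set P := \prod_(i < k) _; nia.
Qed.

Lemma mixed_radix_inj (k : nat) (b u v : 'I_k -> nat) :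
  (forall i, u i < b i) -> (forall i, v i < b i) ->
  mixed_radix b u = mixed_radix b v -> u =1 v.
Proof.
elim: k b u v => [|k IHk] b u v ub vb; first by move=> _ [].
rewrite !mixed_radix_recl => uv.
have b0 : 0 < b ord0 by apply: leq_ltn_trans (ub ord0).
have uv0 : u ord0 = v ord0.
  by have := congr1 (modn^~ (b ord0)) uv; rewrite !modnMDl !modn_small.
move: uv; rewrite uv0 => /addIn/eqP; rewrite eqn_pmul2r // => /eqP uv i.
case: (unliftP ord0 i) => [j ->|-> //].
exact: (IHk (b \o lift ord0) _ _ (fun i => ub _) (fun i => vb _) uv).
Qed.

Section CyclicProduct.
Variables (k : nat) (n : 'I_k -> nat).
Hypothesis n_gt0 : forall i, 0 < n i.

Definition digit (x : cyc_prod n) (i : 'I_k) : nat := x i.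

Definition embed (x : cyc_prod n) : int :=
  (mixed_radix (fun i => 2 * n i) (digit x)).+1%:Z.

Lemma digit_lt x i : digit x i < n i.
Proof. by rewrite -[ltnRHS](prednK (n_gt0 i)) ltn_ord. Qed.

Lemma digitD_lt x y i : digit x i + digit y i < 2 * n i.
Proof. by have := digit_lt x i; have := digit_lt y i; lia. Qed.

Lemma embed_reflects_sum2 : reflects_sum2 embed.
Proof.
move=> x y z w /= exyzw.
have dxyzw := @mixed_radix_inj k (fun i => 2 * n i)
  (fun i => digit x i + digit y i) (fun i => digit z i + digit w i)
  (digitD_lt x y) (digitD_lt z w).
rewrite !mixed_radixD in dxyzw.
apply/ffunP => i; rewrite !ffunE; apply/val_inj => /=.
by congr (_ %% _); apply: dxyzw; move: exyzw; rewrite /embed; lia.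
Qed.

(** Doubling the digits of [x] keeps them below the bases [2 * n i], so the bound
    of [mixed_radix_lt] holds for twice the value. *)
Lemma embed_bound x : 0 < k ->
  mixed_radix (fun i => 2 * n i) (digit x) < 2 ^ (k - 1) * \prod_(i < k) n i.
Proof.
move=> k_gt0; have := mixed_radix_lt (digitD_lt x x).
rewrite mixed_radixD big_split prod_nat_const card_ord /=.
rewrite -[in 2 ^ k](subnK k_gt0) expnD; lia.
Qed.

End CyclicProduct.

Theorem proposition1 (r : nat) (l : 'I_r -> nat) (k : nat) (n : 'I_k -> nat)
  (hr : 1 <= r)
  (hl2 : forall i : 'I_r, 2 <= l i)
  (hl_mono : forall i j : 'I_r, i <= j -> l i <= l j)
  (hk : 1 <= k)
  (hn : forall i : 'I_k, 1 <= n i) :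
  F_grp (cyc_prod n) l <= F_int (2 ^ (k - 1) * \prod_(i < k) n i) l.
Proof.
apply: (max_Lfree_embed hr _ (embed_reflects_sum2 hn)) => [i|x _].
  exact: ltnW (hl2 i).
apply/imfsetP; exists (mixed_radix (fun i => 2 * n i) (digit x)).+1 => //=.
by rewrite mem_iota add1n /= ltnS embed_bound.
Qed.
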